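(* For every uniformly discrete metric space $M$, $D(\mathcal F(M))\le \omega^3$. If moreover $M$ is infinite, then $D(\mathcal F(M))$ is either equal to $\omega^2$ or to $\omega^3$.
   Context: A metric space $(M,d)$ is uniformly discrete if there is $a>0$ with $d(x,y)\ge a$ for all $x\ne y$ in $M$. Lipschitz-free space: for a metric space $M$ with a chosen base point $0$, $\mathrm{Lip}_0(M)$ is the Banach space of Lipschitz functions $f:M\to\mathbb R$ with $f(0)=0$, normed by the best Lipschitz constant; $\delta_M(x)\in \mathrm{Lip}_0(M)^*$ is evaluation at $x$, and $\mathcal F(M)$ is the norm-closed linear span of $\{\delta_M(x):x\in M\}$ in $\mathrm{Lip}_0(M)^*$. Up to linear isometry it does not depend on the base point. Dentability index: all Banach spaces are real. An open slice of a Banach space $X$ is a set $\{x\in X: x^*(x)>a\}$ with $x^*\in X^*$, $a\in\mathbb R$. For $C\subset X$ and $\varepsilon>0$ put $d_\varepsilon(C)=C\setminus\bigcup\{S: S \text{ open slice},\ \mathrm{diam}(S\cap C)<\varepsilon\}$, $d_\varepsilon^0(C)=C$, $d_\varepsilon^{\alpha+1}(C)=d_\varepsilon(d_\varepsilon^\alpha(C))$, and $d_\varepsilon^\beta(C)=\bigcap_{\alpha<\beta}d_\varepsilon^\alpha(C)$ for limit ordinals $\beta$. With $B_X$ the closed unit ball, $D(X,\varepsilon)=\inf\{\alpha: d_\varepsilon^\alpha(B_X)=\emptyset\}$ and $D(X)=\sup_{\varepsilon>0}D(X,\varepsilon)$, with the convention $\inf\emptyset=\infty$ and $\alpha<\infty$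 for every ordinal $\alpha$. Here $\omega$ is the first infinite ordinal, and powers are ordinal powers. *)

(* Defs.v *)
From HB Require Import structures.
From mathcomp Require Import all_boot all_order all_algebra.
From mathcomp Require Import all_classical all_reals all_analysis.

Set Implicit Arguments.
Unset Strict Implicit.
Unset Printing Implicit Defensive.

Import Order.TTheory GRing.Theory Num.Theory.
Import numFieldNormedType.Exports.

Local Open Scope classical_set_scope.
Local Open Scope ring_scope.

(* Ordinals, as the codes generated by zero, successor and suprema of nonempty
   families; distinct codes may denote the same ordinal, so that equality of
   ordinals is [ord_eq], not Leibniz equality. *)
Inductive ord : Type :=
| OZero : ord
| OSucc : ord -> ord
| OSup (J : Type) (j0 : J) (f : J -> ord) : ord.

(* The order of the denoted ordinals:  0 <= b;  a' + 1 <= b' + 1 iff a' <= b';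
   a' + 1 <= sup f iff a' + 1 <= f j for some j;  sup f <= b iff f j <= b for
   every j. *)
Fixpoint ord_le (a : ord) : ord -> Prop :=
  match a with
  | OZero => fun=> True
  | OSucc a' => fix lt_a' (b : ord) : Prop :=
      match b with
      | OZero => False
      | OSucc b' => ord_le a' b'
      | OSup J _ f => exists j : J, lt_a' (f j)
      end
  | OSup J _ f => fun b => forall j : J, ord_le (f j) b
  end.

Definition ord_lt a b := ord_le (OSucc a) b.
Definition ord_eq a b := ord_le a b /\ ord_le b a.
Definition ord_limit b := (exists a, ord_lt a b) /\ forall a, ~ ord_eq b (OSucc a).

Fixpoint ord_add (a b : ord) : ord :=
  match b with
  | OZero => a
  | OSucc b' => OSucc (ord_add a b')
  | OSup J j0 f => OSup j0 (fun j => ord_add a (f j))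
  end.

Fixpoint ord_mul (a b : ord) : ord :=
  match b with
  | OZero => OZero
  | OSucc b' => ord_add (ord_mul a b') a
  | OSup J j0 f => OSup j0 (fun j => ord_mul a (f j))
  end.

Definition ord_exp (a : ord) (n : nat) : ord :=
  iter n (fun b => ord_mul b a) (OSucc OZero).

Definition ord_omega : ord := OSup 0%N (fun n => iter n OSucc OZero).

Lemma ord_le_supr a I (i0 : I) f i : ord_le a (f i) -> ord_le a (OSup i0 f).
Proof.
elim: a => [//|a _|J j0 g IH] /=; first by exists i.
by move=> H j; apply: IH.
Qed.

Lemma ord_lexx a : ord_le a a.
Proof. by elim: a => // I i0 f IH i; apply: ord_le_supr (IH i). Qed.

Lemma ord_le_trans a b c : ord_le a b -> ord_le b c -> ord_le a c.
Proof.
elim: a b c => [//|a IH|I i0 f IH] b c; last first.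
  by move=> H bc i; apply: IH bc; exact: H.
elim: b c => [//|b _|J j0 g IHb] c.
  elim: c => [//|c _|K k0 h IHc] ab; first exact: IH ab.
  by move=> [k bk]; exists k; exact: IHc.
by move=> [j aj] H; exact: IHb aj (H j).
Qed.

Lemma ord_leS a b : ord_le (OSucc a) b -> ord_le a b.
Proof.
suff H c : ord_le c (OSucc c) by exact: ord_le_trans (H a).
elim: c => [//|c //|I i0 f IH] i /=.
apply: ord_le_trans (IH i) _.
exact: (@ord_le_supr _ _ _ f i (ord_lexx _)).
Qed.

Lemma ord_total a b : ord_le a b \/ ord_lt b a.
Proof.
elim: a b => [|a IH|I i0 f IH] b; first by left.
- elim: b => [|b _|J j0 g IHb]; first by right.
    by case: (IH b) => ?; [left|right].
  have [[j aj]|/forallNP H] := pselect (exists j, ord_le (OSucc a) (g j)).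
    by left; exists j.
  by right => /= j; case: (IHb j) => // /H.
- have [[i bi]|/forallNP H] := pselect (exists i, ord_lt b (f i)).
    by right; exists i.
  by left => i; case: (IH i b) => // /H.
Qed.

Lemma ord_ltxx a : ~ ord_lt a a.
Proof.
elim: a => [//|a IH //|I i0 f IH] [i H].
apply: (IH i); apply: (@ord_le_trans _ (OSucc (OSup i0 f)) _ _ H).
exact: (@ord_le_supr _ _ _ f i (ord_lexx _)).
Qed.

Lemma ord_lt_wf : well_founded ord_lt.
Proof.
suff H b a : ord_le a b -> Acc ord_lt a by move=> a; exact: H (ord_lexx a).
elim: b a => [|b IH|I i0 f IH] a ab; constructor => c ca.
- by have := ord_le_trans ca ab.
- exact: IH (ord_le_trans ca ab).
- have [i ci] := ord_le_trans ca ab.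
  exact: IH (ord_leS ci).
Qed.

Definition ord_least (P : set ord) (a : ord) := P a /\ forall b, P b -> ord_le a b.

Lemma ord_least_ex (P : set ord) : P !=set0 -> exists a, ord_least P a.
Proof.
case=> a; elim/(well_founded_ind ord_lt_wf): a => a IH Pa.
have [[b [ba Pb]]|H] := pselect (exists b, ord_lt b a /\ P b); first exact: IH Pb.
exists a; split => // b Pb; case: (ord_total a b) => // ba.
by case: H; exists b.
Qed.


Inductive xord : Type := XFin of ord | XInfty.

Definition xord_le (a b : xord) : Prop :=
  match a, b with
  | _, XInfty => True
  | XInfty, XFin _ => False
  | XFin a', XFin b' => ord_le a' b'
  end.

Definition xord_eq (a b : xord) := xord_le a b /\ xord_le b a.

Definition xord_inf (P : set ord) : xord :=
  match pselect (P !=set0) with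
  | left P0 => XFin (sval (cid (ord_least_ex P0)))
  | right _ => XInfty
  end.

Definition xord_sup (J : Type) (j0 : J) (F : J -> xord) : xord :=
  if `[< exists j, F j = XInfty >] then XInfty
  else XFin (OSup j0 (fun j => if F j is XFin a then a else OZero)).

Lemma xord_infP (P : set ord) (b : xord) :
  xord_le b (xord_inf P) <-> forall a, P a -> xord_le b (XFin a).
Proof.
rewrite /xord_inf; case: pselect => [P0|P0].
  case: (cid _) => /= c [Pc cP]; split=> [bc a /cP|]; last exact.
  by case: b bc => //= b bc; exact: ord_le_trans.
by split=> [_ a Pa|_]; [case: P0; exists a|case: b].
Qed.

Lemma xord_supP J (j0 : J) (F : J -> xord) (b : xord) :
  xord_le (xord_sup j0 F) b <-> forall j, xord_le (F j) b.
Proof.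
rewrite /xord_sup; case: asboolP => [[j Fj]|/forallNP FN].
  case: b => [b|]; split=> //; first by move=> /(_ j); rewrite Fj.
  by move=> _ k; case: (F k).
case: b => [b|]; last by split=> // _ j; case: (F j).
by split=> /= H j; have := H j; have := FN j; case: (F j).
Qed.

Section Dual.
Context (R : realType) (X : normedModType R).

Definition dual_pred : {pred X -> R^o} :=
  mem [set f : X -> R^o | linear f /\ continuous f].

Record dual := Dual { dual_fun :> X -> R^o; _ : dual_fun \in dual_pred }.

HB.instance Definition _ := [isSub for dual_fun].
HB.instance Definition _ := [Choice of dual by <:].

Lemma dual_submod_closed : submod_closed dual_pred.
Proof.
split.
  rewrite inE; split; first by move=> a u v; rewrite scaler0 addr0.
  by move=> x; exact: cvg_cst.
move=> a f g; rewrite !inE => -[lf cf] [lg cg]; split.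
  move=> k u v; rewrite /= !fctE lf lg scalerDr (scalerA a k) mulrC -scalerA.
  by rewrite addrACA -scalerDr.
by move=> x; apply: cvgD (cg x); apply: cvgZr; exact: cf.
Qed.

HB.instance Definition _ :=
  GRing.isSubmodClosed.Build _ _ dual_pred dual_submod_closed.
HB.instance Definition _ := [SubChoice_isSubLmodule of dual by <:].

Definition dual_norm (f : dual) : R :=
  sup [set `|f x| | x in [set x | `|x| <= 1]].

Lemma dual_linear (f : dual) : linear f.
Proof. by case: f => f /=; rewrite inE => -[]. Qed.

Lemma dual_continuous (f : dual) : continuous f.
Proof. by case: f => f /=; rewrite inE => -[]. Qed.

Lemma dual_bounded (f : dual) : exists r, forall x, `|f x| <= r * `|x|.
Proof.
pose F : {linear X -> R^o} := HB.pack (f : X -> R^o)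
  (GRing.isLinear.Build _ _ _ _ (f : X -> R^o) (dual_linear f)).
have /linear_bounded_continuous/linear_boundedP : continuous F.
  exact: dual_continuous.
by case/pinfty_ex_gt0 => r r0 fr; exists r.
Qed.

Lemma dual_norm_leP (f : dual) (c : R) : 0 <= c ->
  dual_norm f <= c <-> forall x, `|f x| <= c * `|x|.
Proof.
have fZ a x : f (a *: x) = a * f x.
  by have := dual_linear f a x 0; rewrite !addr0 => ->;
     have := dual_linear f 1 0 0; rewrite !scale1r addr0 => /esym/eqP;
     rewrite -subr_eq0 addrK => /eqP ->; rewrite addr0.
move=> c0; split => [fc x|fc].
  have [->|x0] := eqVneq x 0.
    by have := fZ 0 0; rewrite scale0r mul0r => ->; rewrite !normr0 mulr0.
  have nx0 : 0 < `|x| by rewrite normr_gt0.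
  rewrite -ler_pdivrMr// mulrC -[`|x|^-1]ger0_norm ?invr_ge0// -normrM -fZ.
  apply: le_trans fc; apply: ub_le_sup.
    have [r fr] := dual_bounded f; exists `|r| => _ [y /= y1 <-].
    rewrite (le_trans (fr y))// (le_trans (ler_norm _))// normrM normr_id.
    by rewrite ler_piMr.
  by exists (`|x|^-1 *: x) => //=; rewrite normfZV.
apply: ge_sup.
  by exists `|f 0|, 0 => //=; rewrite normr0.
by move=> _ [x /= x1 <-]; rewrite (le_trans (fc x))// ler_piMr.
Qed.

Lemma dual_norm_ge0 (f : dual) : 0 <= dual_norm f.
Proof.
rewrite leNgt; apply/negP => f0.
have := (dual_norm_leP f (lexx 0)).1 (ltW f0) => f00.
have : (0 : R) <= dual_norm f; last by rewrite leNgt f0.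
apply: ub_le_sup.
  by exists 0 => _ [x _ <-]; rewrite (le_trans (f00 x))// mul0r.
exists 0 => /=; first by rewrite normr0.
by apply/eqP; rewrite eq_le normr_ge0 andbT (le_trans (f00 0))// mul0r.
Qed.

Lemma le_dual_norm (f : dual) (x : X) : `|f x| <= dual_norm f * `|x|.
Proof. exact: (dual_norm_leP f (dual_norm_ge0 f)).1. Qed.

Lemma dual_normD f g : dual_norm (f + g) <= dual_norm f + dual_norm g.
Proof.
apply/dual_norm_leP; first by rewrite addr_ge0// dual_norm_ge0.
move=> x; rewrite mulrDl (le_trans (ler_normD (f x) (g x)))//.
by rewrite lerD// le_dual_norm.
Qed.

Lemma dual_normZ (l : R) f : dual_norm (l *: f) = `|l| * dual_norm f.
Proof.
have le k g : dual_norm (k *: g) <= `|k| * dual_norm g.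
  apply/dual_norm_leP; first by rewrite mulr_ge0// dual_norm_ge0.
  move=> x; rewrite -mulrA [`| _ |](_ : _ = `|k| * `|g x|); last exact: (normrM k (g x)).
  by rewrite ler_wpM2l// le_dual_norm.
apply/eqP; rewrite eq_le le /=.
have [->|l0] := eqVneq l 0; first by rewrite normr0 mul0r dual_norm_ge0.
rewrite -ler_pdivlMl ?normr_gt0// -normfV -{1}[f](scalerK l0); exact: le.
Qed.

Lemma dual_norm0_eq0 f : dual_norm f = 0 -> f = 0.
Proof.
move=> f0; apply/val_inj/funext => x /=; apply/eqP.
by rewrite -normr_le0 (le_trans (le_dual_norm f x))// f0 mul0r.
Qed.

HB.instance Definition _ :=
  Lmodule_isNormed.Build R dual dual_normD dual_normZ dual_norm0_eq0.

End Dual.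

Section Lip0.
Context (R : realType) (M : metricType R) (o : M).

(* The condition [0 <= k] matters only when [M] is a singleton. *)
Definition lipschitz_const (f : M -> R) (k : R) :=
  0 <= k /\ forall x y, `|f x - f y| <= k * mdist x y.

Definition Lip0_pred : {pred M -> R^o} :=
  mem [set f : M -> R^o | f o = 0 /\ exists k, lipschitz_const f k].

Record Lip0 := MkLip0 { Lip0_fun :> M -> R^o; _ : Lip0_fun \in Lip0_pred }.

HB.instance Definition _ := [isSub for Lip0_fun].
HB.instance Definition _ := [Choice of Lip0 by <:].

Lemma lipschitz_constD f g k l : lipschitz_const f k -> lipschitz_const g l ->
  lipschitz_const (f \+ g) (k + l).
Proof.
move=> [k0 fk] [l0 gl]; split; first exact: addr_ge0.
move=> x y /=; rewrite opprD addrACA mulrDl (le_trans (ler_normD _ _))//.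
exact: lerD.
Qed.

Lemma lipschitz_constZ a f k : lipschitz_const f k ->
  lipschitz_const (fun x => a * f x) (`|a| * k).
Proof.
move=> [k0 fk]; split; first exact: mulr_ge0.
by move=> x y; rewrite -mulrBr normrM -mulrA ler_wpM2l.
Qed.

Lemma Lip0_submod_closed : submod_closed Lip0_pred.
Proof.
split.
  rewrite inE; split => //; exists 0; split => // x y.
  by rewrite subrr normr0 mul0r.
move=> a f g; rewrite !inE => -[f0 [k fk]] [g0 [l gl]]; split.
  by rewrite /= !fctE f0 g0 scaler0 addr0.
exists (`|a| * k + l).
exact: (lipschitz_constD (lipschitz_constZ a fk) gl).
Qed.

HB.instance Definition _ :=
  GRing.isSubmodClosed.Build _ _ Lip0_pred Lip0_submod_closed.
HB.instance Definition _ := [SubChoice_isSubLmodule of Lip0 by <:].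

Definition Lip0_norm (f : Lip0) : R := inf [set k | lipschitz_const f k].

Lemma Lip0_base (f : Lip0) : f o = 0.
Proof. by case: f => f /=; rewrite inE => -[]. Qed.

Lemma Lip0_norm_le (f : Lip0) k : lipschitz_const f k -> Lip0_norm f <= k.
Proof. by move=> fk; apply: ge_inf => //; exists 0 => ? []. Qed.

Lemma Lip0_normP (f : Lip0) : lipschitz_const f (Lip0_norm f).
Proof.
have [k fk] : exists k, lipschitz_const f k.
  by case: f => f /=; rewrite inE => -[].
have ne : [set k | lipschitz_const f k] !=set0 by exists k.
split; first by apply: lb_le_inf => // ? [].
move=> x y; have [->|xy] := eqVneq x y.
  by rewrite subrr normr0 mdistxx mulr0.
have d0 : 0 < mdist x y by rewrite mdist_gt0.
rewrite -ler_pdivrMr//; apply: lb_le_inf => // l [_ fl].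
by rewrite ler_pdivrMr.
Qed.

Lemma Lip0_norm_ge0 (f : Lip0) : 0 <= Lip0_norm f.
Proof. by have [] := Lip0_normP f. Qed.

Lemma Lip0_normD f g : Lip0_norm (f + g) <= Lip0_norm f + Lip0_norm g.
Proof.
apply: Lip0_norm_le; exact: (lipschitz_constD (Lip0_normP f) (Lip0_normP g)).
Qed.

Lemma Lip0_normZ (l : R) f : Lip0_norm (l *: f) = `|l| * Lip0_norm f.
Proof.
have le k g : Lip0_norm (k *: g) <= `|k| * Lip0_norm g.
  apply: Lip0_norm_le; exact: (lipschitz_constZ k (Lip0_normP g)).
apply/eqP; rewrite eq_le le /=.
have [->|l0] := eqVneq l 0; first by rewrite normr0 mul0r Lip0_norm_ge0.
rewrite -ler_pdivlMl ?normr_gt0// -normfV -{1}[f](scalerK l0); exact: le.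
Qed.

Lemma le_Lip0_norm (f : Lip0) x : `|f x| <= mdist x o * Lip0_norm f.
Proof. by have [_ /(_ x o)] := Lip0_normP f; rewrite Lip0_base subr0 mulrC. Qed.

Lemma Lip0_norm0_eq0 f : Lip0_norm f = 0 -> f = 0.
Proof.
move=> f0; apply/val_inj/funext => x /=; apply/eqP.
by rewrite -normr_le0 (le_trans (le_Lip0_norm f x))// f0 mulr0.
Qed.

HB.instance Definition _ :=
  Lmodule_isNormed.Build R Lip0 Lip0_normD Lip0_normZ Lip0_norm0_eq0.

Lemma eval_dual (x : M) : (fun f : Lip0 => f x) \in @dual_pred R Lip0.
Proof.
rewrite inE; split => [//|].
pose F : {linear Lip0 -> R^o} := HB.pack (fun f : Lip0 => (f x : R^o))
  (GRing.isLinear.Build _ _ _ _ (fun f : Lip0 => (f x : R^o))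
    (fun a u v => erefl)).
apply: (@bounded_linear_continuous _ _ _ F); apply/linear_boundedP.
exists (mdist x o); split=> [|r /ltW dr f]; first exact: num_real.
by rewrite (le_trans (le_Lip0_norm f x))// ler_wpM2r// Lip0_norm_ge0.
Qed.

Definition delta (x : M) : dual Lip0 := Dual (eval_dual x).

End Lip0.

Definition lin_span (R : realType) (V : lmodType R) (A : set V) : set V :=
  [set v | exists n (c : 'I_n -> R) (a : 'I_n -> V),
     (forall i, A (a i)) /\ v = \sum_(i < n) c i *: a i].

Section Free.
Context (R : realType) (M : metricType R) (o : M).

Definition free_pred : {pred dual (Lip0 o)} :=
  mem (closure (lin_span (range (delta o)))).

Record lipschitz_free :=
  LipFree { free_val :> dual (Lip0 o); _ : free_val \in free_pred }.

HB.instance Definition _ := [isSub for free_val].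
HB.instance Definition _ := [Choice of lipschitz_free by <:].

Lemma free_submod_closed : submod_closed free_pred.
Proof.
have clP (A : set (dual (Lip0 o))) v : closure A v <->
    forall e, 0 < e -> exists2 w, A w & `|v - w| < e.
  split=> [cA e e0|cA B /nbhs_normP[e /= e0 eB]].
    have [] := cA (ball v e); first exact: nbhsx_ballx.
    by move=> w [Aw]; rewrite -ball_normE /= => vw; exists w.
  by have [w Aw vw] := cA e e0; exists w; split => //; exact: eB.
split.
  rewrite inE; apply: subset_closure.
  exists 0%N, (fun=> 0), (fun=> 0); split; first by case.
  by rewrite big_ord0.
move=> a u v; rewrite !inE => /clP cu /clP cv; apply/clP => e e0.
have a0 : 0 < `|a| + 1 by rewrite ltr_wpDl.
have [] := cu (e / 2 / (`|a| + 1)); first by rewrite !divr_gt0.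
move=> u' [n [c [b [Ab u'E]]]] uu'.
have [|v' [m [d [b' [Ab' v'E]]]] vv'] := cv (e / 2); first by rewrite divr_gt0.
exists (a *: u' + v').
  exists (n + m)%N, (fun i => match fintype.split i with
                              | inl j => a * c j | inr j => d j end),
    (fun i => match fintype.split i with inl j => b j | inr j => b' j end).
  split; first by move=> i /=; case: fintype.split.
  rewrite big_split_ord /= u'E v'E scaler_sumr; congr (_ + _).
    apply: eq_bigr => i _.
    by rewrite -[lshift _ _]/(unsplit (inl i)) unsplitK scalerA.
  by apply: eq_bigr => i _; rewrite -[rshift _ _]/(unsplit (inr i)) unsplitK.
rewrite opprD addrACA -scalerBr (splitr e).
rewrite (le_lt_trans (ler_normD _ _))// ltrD// normrZ.
rewrite (@le_lt_trans _ _ ((`|a| + 1) * `|u - u'|))//.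
  by rewrite ler_wpM2r// lerDl.
by rewrite -ltr_pdivlMl// mulrC.
Qed.

HB.instance Definition _ :=
  GRing.isSubmodClosed.Build _ _ free_pred free_submod_closed.
HB.instance Definition _ := [SubChoice_isSubLmodule of lipschitz_free by <:].

Let free_norm (v : lipschitz_free) : R := `|val v|.

Let free_normD u v : free_norm (u + v) <= free_norm u + free_norm v.
Proof. exact: ler_normD. Qed.

Let free_normZ (l : R) v : free_norm (l *: v) = `|l| * free_norm v.
Proof. exact: normrZ. Qed.

Let free_norm0_eq0 v : free_norm v = 0 -> v = 0.
Proof. by move=> /normr0_eq0 v0; exact: val_inj. Qed.

HB.instance Definition _ := Lmodule_isNormed.Build R lipschitz_free
  free_normD free_normZ free_norm0_eq0.

End Free.

Section Dentability.
Context (R : realType) (X : normedModType R).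

Definition open_slice (S : set X) : Prop :=
  exists (f : dual X) (a : R), S = [set x | a < f x].

(* [diam set0] is -oo rather than 0, which is immaterial when it is compared
   with some [0 < e]. *)
Definition diam (A : set X) : \bar R :=
  ereal_sup [set `|xy.1 - xy.2|%:E | xy in A `*` A].

Definition dent_deriv (e : R) (C : set X) : set X :=
  C `\` \bigcup_(S in [set S | open_slice S /\ (diam (S `&` C) < e%:E)%E]) S.

(* By [dent_iter_anti] the result depends only on the ordinal denoted by [a].
   The family [f] need not be increasing; [dent_iter_limit] is the usual clause
   (the intersection over all smaller ordinals) at limit ordinals. *)
Fixpoint dent_iter (e : R) (C : set X) (a : ord) : set X :=
  match a with
  | OZero => C
  | OSucc a' => dent_deriv e (dent_iter e C a')
  | OSup J _ f => \bigcap_(j in [set: J]) dent_iter e C (f j)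
  end.

Lemma dent_deriv_sub e C : dent_deriv e C `<=` C.
Proof. by move=> x []. Qed.

Lemma dent_deriv_mono e C C' : C `<=` C' -> dent_deriv e C `<=` dent_deriv e C'.
Proof.
move=> CC' x [Cx NS]; split; first exact: CC'.
move=> [S [sS dS] Sx]; apply: NS; exists S => //; split => //.
apply: le_lt_trans dS; apply: ereal_sup_le => _ [[y z] /= [[Sy Cy] [Sz Cz]] <-].
by exists (y, z) => //; do 2 split => //; exact: CC'.
Qed.

Lemma dent_iter_sub e C a : dent_iter e C a `<=` C.
Proof.
elim: a => [//|a IH|J j0 f IH] x /=; first by move=> /dent_deriv_sub/IH.
by move=> /(_ j0 I); exact: IH.
Qed.

Lemma dent_iter_anti e C a b :
  ord_le a b -> dent_iter e C b `<=` dent_iter e C a.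
Proof.
elim: a b => [|a IH|J j0 f IH] b; first by move=> _; exact: dent_iter_sub.
- elim: b => [//|b _|K k0 g IHb] /=; first by move=> /IH; exact: dent_deriv_mono.
  by move=> [k ak] x /(_ k I); exact: IHb.
- by move=> fb x bx j _; exact: IH (fb j) _ bx.
Qed.

Lemma dent_iter_limit e C b : ord_limit b ->
  dent_iter e C b = \bigcap_(a in [set a | ord_lt a b]) dent_iter e C a.
Proof.
move=> [[a0 a0b] bN]; apply/seteqP; split=> [x bx a /= /ord_leS ab|].
  exact: dent_iter_anti ab _ bx.
elim: b a0b bN => [//|b _ _ /(_ b) []|J j0 f IH a0b bN x bx j _].
  by split; exact: ord_lexx.
have fb : ord_le (f j) (OSup j0 f) by exact: (@ord_le_supr _ _ _ f j (ord_lexx _)).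
case: (ord_total (OSucc (f j)) (OSup j0 f)) => [/bx//|bf].
have fb' : ord_le (OSup j0 f) (f j) := bf.
apply: IH => [|a [fa af]|a /= afj]; first exact: ord_le_trans a0b fb'.
  by apply: (bN a); split; [exact: ord_le_trans fb' fa|exact: ord_le_trans af fb].
by apply: bx; exact: ord_le_trans afj fb.
Qed.

Definition dent_index_eps (e : R) : xord :=
  xord_inf [set a | dent_iter e [set x : X | `|x| <= 1] a = set0].

Definition dent_index : xord :=
  xord_sup (exist (fun e : R => 0 < e) 1 ltr01) (fun e => dent_index_eps (sval e)).

End Dentability.

Definition uniformly_discrete (R : realType) (M : metricType R) : Prop :=
  exists2 a : R, 0 < a & forall x y : M, x <> y -> a <= mdist x y.

(* Main.v *)
From HB Require Import structures.
Require Import Defs.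
From mathcomp Require Import all_boot all_order all_algebra.
From mathcomp Require Import all_classical all_reals all_analysis.
From mathcomp Require Import ring lra.

(** Write X for F(M), B for its unit ball and |z| for the distance from z to
    the base point.

    Three values become two.  If some derived set of B of order alpha is
    nonempty for a given e, then by symmetry and midpoint convexity it contains
    0, hence the derived set for e / 2 contains B / 2, because y / 2 + B / 2 is
    included in B whenever y is in B.  Iterating, the derived sets of order
    alpha * k for e / 2 ^ k are nonempty ([iter_dent_iter_neq0]), so the
    dentability index is at least alpha * omega.  In particular an index above
    omega ^ 2 is at least omega ^ 3 ([dent_index_dichotomy]).

    The index is at least omega ^ 2 when M is infinite.  By the previous
    paragraph it suffices that the derived set of order omega be nonempty for
    some e, and this follows from separated dyadic trees of arbitrary height
    ([dent_index_ge_tree]).  M contains a sequence u such that u_i is at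
    distance at least c |u_i| from all the other u_j ([spread_exists]): points
    escaping to infinity, or any distinct points if M is bounded.  The
    normalised evaluations at the u_i behave like the unit vectors of l_1, and
    their dyadic averages form the trees ([dyadic_mean_spread]).

    The index is at most omega ^ 3.  The mechanism is uniform convexity: if
    q is a linear functional plus a small multiple of a sum of finitely many
    squares of functionals, if q <= rho on C, and if points of C where q is
    large are e / 2 close once these finitely many functionals are close, then
    finitely many derivations lower the supremum of q on C by a fixed amount
    ([iter_dent_deriv_quadratic_le]); q is a supremum of affine functions, and
    these provide the slices.  This is the innermost of three levels, each of
    which costs a factor omega.  Let C be a set of points of norm at most
    s <= 1, d = e / 36, and f a 1-Lipschitz function supported in a ball.
    - If x(f) > s - 3 d, then x is concentrated on a larger ball:
      a 1-Lipschitz g vanishing far away from the support of f has |x(g)| at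
      most about 4 d, since f + g is almost 1-Lipschitz ([Lip0_glue],
      [norm_sub_le_near]).
    - On a fixed ball of radius r the Lipschitz and supremum norms of functions
      are comparable, by uniform discreteness, so that there X looks like l_1.
      To the functional x(f) one adds k |x|_1, where |x|_1 is the l_1 norm of
      the part of x on the ball, in the guise of all the functionals x(f) + k
      x(g) with |g| <= 1 on the ball.  If x(f) + k x(g) is nearly maximal for
      some g of finite support N, then also the l_1 mass of x off N is small,
      so only the coordinates in N are left free, and squares of these are
      added.  Hence omega derivations lower the supremum of x(f) + k |x|_1 by a
      fixed amount ([D1_perturbed_functional_le]); finitely many repetitions
      bring x(f) below s - d ([iter_D1_functional_le]).
    - Such f are norming, so omega ^ 2 derivations take the norm from s to
      s - d ([D2_norm_le]), and finitely many repetitions leave nothing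
      ([dent_iter_omega3]). *)

Set Implicit Arguments.
Unset Strict Implicit.
Unset Printing Implicit Defensive.
Import Order.TTheory GRing.Theory Num.Theory.
Import numFieldNormedType.Exports.
Local Open Scope classical_set_scope.
Local Open Scope ring_scope.

(** * Functionals on a normed space *)

Section DualEval.
Context (R : realType) (X : normedModType R).
Implicit Types (f g : dual X) (x y : X).

Lemma dual_funD f x y : f (x + y) = f x + f y.
Proof. by have := dual_linear f 1 x y; rewrite !scale1r. Qed.

Lemma dual_fun0 f : f 0 = 0.
Proof. by apply: (addIr (f 0)); rewrite -dual_funD addr0 add0r. Qed.

Lemma dual_funZ f (a : R) x : f (a *: x) = a * f x.
Proof. by have := dual_linear f a x 0; rewrite dual_fun0 !addr0. Qed.

Lemma dual_funB f x y : f (x - y) = f x - f y.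
Proof. by rewrite dual_funD -scaleN1r dual_funZ mulN1r. Qed.

Lemma dual_funN f x : f (- x) = - f x.
Proof. by rewrite -scaleN1r dual_funZ mulN1r. Qed.

Lemma dual_addE f g x : (f + g) x = f x + g x.
Proof. by []. Qed.

Lemma dual_sumE (I : Type) (s : seq I) (P : pred I) (F : I -> dual X) x :
  (\sum_(i <- s | P i) F i) x = \sum_(i <- s | P i) F i x.
Proof. by elim/big_rec2 : _ => // i a b _ <-. Qed.

Lemma dual_bounded_fun (F : X -> R^o) (r : R) :
  linear F -> (forall x, `|F x| <= r * `|x|) -> F \in @dual_pred R X.
Proof.
move=> Flin Fr; rewrite inE; split=> //.
pose G : {linear X -> R^o} := HB.pack F (GRing.isLinear.Build _ _ _ _ F Flin).
apply: (@bounded_linear_continuous _ _ _ G); apply/linear_boundedP.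
exists r; split=> [|s /ltW rs x]; first exact: num_real.
by rewrite (le_trans (Fr x))// ler_wpM2r.
Qed.
End DualEval.

(** * Iterated dentability derivations *)

Section Derivation.
Context (R : realType) (X : normedModType R).
Implicit Types (C : set X) (e : R) (a : ord).

Lemma diam_ltP (A : set X) e : (diam A < e%:E)%E <->
  exists2 r, r < e & forall x y, A x -> A y -> `|x - y| <= r.
Proof.
split=> [dA|[r re H]]; last first.
  apply: le_lt_trans (_ : (r%:E < e%:E)%E); last by rewrite lte_fin.
  by apply: ge_ereal_sup => _ [[x y] [/= Ax Ay] <-]; rewrite lee_fin H.
have le r : (diam A <= r%:E)%E -> forall x y, A x -> A y -> `|x - y| <= r.
  move=> Ar x y Ax Ay; rewrite -lee_fin (le_trans _ Ar)//.
  by apply: ereal_sup_ubound; exists (x, y).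
case E : (diam A) dA => [r| |] // dA.
  by exists r; [rewrite -lte_fin|apply: le; rewrite E].
by exists (e - 1); [rewrite ltrBlDr ltrDl|apply: le; rewrite E leNye].
Qed.

Lemma dent_derivP e C x : dent_deriv e C x <->
  C x /\ forall (f : dual X) (b r : R), b < f x -> r < e ->
    exists y z, [/\ C y, C z, b < f y, b < f z & r < `|y - z|].
Proof.
split=> [[Cx N]|[Cx N]]; split=> //.
  move=> f b r bf re; apply: contrapT => H; apply: N.
  exists [set y | b < f y] => //; split; first by exists f, b.
  apply/diam_ltP; exists r => // y z [/= fy Cy] [/= fz Cz].
  by rewrite leNgt; apply/negP => ryz; apply: H; exists y, z.
move=> [S [[f [b ->]] /diam_ltP[r re Sr]] /= bf].
have [y [z [Cy Cz fy fz]]] := N f b r bf re.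
by rewrite ltNge Sr.
Qed.

Lemma dent_iter_add e C a b :
  dent_iter e C (ord_add a b) = dent_iter e (dent_iter e C a) b.
Proof.
elim: b => [//|b IH|J j0 f IH] /=; first by rewrite IH.
by apply: eq_bigcapr => j _; exact: IH.
Qed.

Lemma dent_iter_mul e C a n :
  dent_iter e C (ord_mul a (iter n OSucc OZero)) =
  iter n (fun D => dent_iter e D a) C.
Proof. by elim: n => //= n IH; rewrite dent_iter_add IH. Qed.

(** Derivations of order [omega ^ n.+1] are countable intersections of finite
    iterates of derivations of order [omega ^ n]: from here on no ordinal
    arithmetic is needed. *)
Lemma dent_iter_exp e C n : dent_iter e C (ord_exp ord_omega n.+1) =
  \bigcap_k iter k (fun D => dent_iter e D (ord_exp ord_omega n)) C.
Proof.
rewrite {1}/ord_exp iterS -/(ord_exp _ n) /ord_omega /=.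
by apply: eq_bigcapr => k _; rewrite dent_iter_mul.
Qed.

Lemma dent_iter_anti_eps e e' C a : e' <= e ->
  dent_iter e C a `<=` dent_iter e' C a.
Proof.
move=> e'e; elim: a => [//|a IH|J j0 f IH] /=; last first.
  by move=> x Cx j _; apply: IH; exact: Cx.
move=> x /dent_derivP[Cx N]; apply/dent_derivP; split=> [|f b r bf re].
  exact: IH.
have [y [z [Cy Cz fy fz yz]]] := N f b r bf (lt_le_trans re e'e).
by exists y, z; split=> //; exact: IH.
Qed.

(** Slices are carried to slices by affine maps.  Besides homothety, this gives
    symmetry ([t = -1]) and monotonicity in the set. *)
Lemma dent_iter_affine e C C' a (v : X) (t : R) : t != 0 ->
  (forall x, C x -> C' (v + t *: x)) ->
  forall x, dent_iter e C a x -> dent_iter (`|t| * e) C' a (v + t *: x).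
Proof.
move=> t0 CC'; have t0' : 0 < `|t| by rewrite normr_gt0.
elim: a => [//|a IH|J j0 f IH] /= x; last first.
  by move=> Cx j _; apply: IH; exact: Cx.
move=> /dent_derivP[Cx N]; apply/dent_derivP; split=> [|f b r].
  exact: IH.
rewrite dual_funD dual_funZ => bf re.
have [||y [z [Cy Cz fy fz yz]]] := N (t *: f) (b - f v) (`|t|^-1 * r).
- by rewrite ltrBlDl.
- by rewrite ltr_pdivrMl.
exists (v + t *: y), (v + t *: z); split; first exact: IH.
- exact: IH.
- by rewrite dual_funD dual_funZ -ltrBlDl.
- by rewrite dual_funD dual_funZ -ltrBlDl.
- by rewrite opprD addrACA subrr add0r -scalerBr normrZ -ltr_pdivrMl.
Qed.

Definition midpoint_closed C :=
  forall x y, C x -> C y -> C (2^-1 *: (x + y)).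

Lemma dual_fun_midpoint (f : dual X) x y :
  f (2^-1 *: (x + y)) = (f x + f y) / 2.
Proof. by rewrite dual_funZ dual_funD mulrC. Qed.

Lemma dent_iter_midpoint e C a : midpoint_closed C ->
  midpoint_closed (dent_iter e C a).
Proof.
move=> Cm; elim: a => [//|a IH|J j0 f IH] /= x y; last first.
  by move=> Cx Cy j _; apply: IH; [exact: Cx|exact: Cy].
move=> /dent_derivP[Cx Nx] /dent_derivP[Cy Ny]; apply/dent_derivP.
split=> [|f b r]; first exact: IH.
rewrite dual_fun_midpoint => bf re.
have [fx|fx] := ltP b (f x); first exact: Nx.
have [fy|fy] := ltP b (f y); first exact: Ny.
by exfalso; lra.
Qed.

(** A slice through the midpoint contains one of the two ends, hence a segment
    of half the length.  This is what makes dyadic trees survive. *)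
Lemma dent_deriv_midpoint e C x y : midpoint_closed C -> C x -> C y ->
  2 * e <= `|x - y| -> dent_deriv e C (2^-1 *: (x + y)).
Proof.
move=> Cm Cx Cy exy; apply/dent_derivP; split=> [|f b r bf re]; first exact: Cm.
have h (u v : X) : `|2^-1 *: (u + v) - u| = 2^-1 * `|u - v|.
  have -> : 2^-1 *: (u + v) - u = - (2^-1 *: (u - v)).
    rewrite -scalerN opprB -{2}[u]scale1r -scaleNr -[in LHS](addrC v) scalerDr.
    rewrite -addrA -scalerDl [_ + - 1](_ : _ = - 2^-1); last by lra.
    by rewrite scaleNr -scalerBr.
  by rewrite normrN normrZ ger0_norm// invr_ge0.
have [fx|fx] := ltP b (f x).
  exists (2^-1 *: (x + y)), x; split=> //; first exact: Cm.
  by rewrite h; lra.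
have [fy|fy] := ltP b (f y).
  exists (2^-1 *: (x + y)), y; split=> //; first exact: Cm.
  by rewrite (addrC x) h distrC; lra.
by rewrite dual_fun_midpoint in bf; exfalso; lra.
Qed.

Lemma sumr_sqr_midpoint (cs : seq (dual X)) y z :
  \sum_(c <- cs) (c (2^-1 *: (y + z))) ^+ 2 =
  (\sum_(c <- cs) (c y) ^+ 2 + \sum_(c <- cs) (c z) ^+ 2) / 2
  - (\sum_(c <- cs) (c (y - z)) ^+ 2) / 4.
Proof.
elim: cs => [|c cs IH]; first by rewrite !big_nil; lra.
by rewrite !big_cons IH dual_fun_midpoint dual_funB; field.
Qed.

(** Uniform convexity.  At a midpoint of [y] and [z], [q] is below the mean of
    [q y] and [q z] by a quarter of [k] times the sum of the [(c (y - z)) ^+ 2].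
    So a slice on which an affine minorant of [q] exceeds [rho - d], where
    [q <= rho] on the set, contains only points with this quantity less than
    [d], and the last assumption makes the slice small: each derivation lowers
    the supremum of [q] by [d] until [r] is reached. *)
Lemma iter_dent_deriv_quadratic_le e C (l : dual X) (cs : seq (dual X)) (k r d : R) :
  let q y := l y + k * \sum_(c <- cs) (c y) ^+ 2 in
  0 < e -> 0 < k -> 0 < d ->
  (exists rho, forall y, C y -> q y <= rho) ->
  (forall y z, C y -> C z -> r < q y -> r < q z ->
     k * \sum_(c <- cs) (c (y - z)) ^+ 2 < 4 * d -> `|y - z| <= e / 2) ->
  exists J, forall x, iter J (dent_deriv e) C x -> q x <= r.
Proof.
move=> q e0 k0 d0 [rho Crho] close.
have qmid y z : q (2^-1 *: (y + z)) =
    (q y + q z) / 2 - k * (\sum_(c <- cs) (c (y - z)) ^+ 2) / 4.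
  by rewrite /q sumr_sqr_midpoint dual_fun_midpoint; field.
(* the tangent at x *)
have minorant x : exists (h : dual X) (b : R),
    (forall y, h y - b <= q y) /\ h x - b = q x.
  exists (l + \sum_(c <- cs) (2 * k * c x) *: c), (k * \sum_(c <- cs) (c x) ^+ 2).
  have E y : (l + \sum_(c <- cs) (2 * k * c x) *: c) y =
      l y + \sum_(c <- cs) 2 * k * c x * c y.
    by rewrite dual_addE dual_sumE.
  split=> [y|]; rewrite E /q -addrA lerD2l || rewrite E /q -addrA; last first.
    congr (_ + _); apply/eqP; rewrite subr_eq; apply/eqP.
    elim: {close qmid q Crho E} cs => [|c cs IH].
      by rewrite !big_nil; ring.
    by rewrite !big_cons IH; ring.
  elim: {close qmid q Crho E} cs => [|c cs IH].
    by rewrite !big_nil mulr0 subr0.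
  rewrite !big_cons; have : 0 <= k * (c x - c y) ^+ 2.
    by rewrite mulr_ge0 ?sqr_ge0// ltW.
  by move: IH; nra.
have step D s : D `<=` C -> (forall y, D y -> q y <= s) ->
    forall x, dent_deriv e D x -> q x <= Num.max r (s - d).
  move=> DC Ds x /dent_derivP[Dx N]; rewrite leNgt; apply/negP => qx.
  have [h [b [hq hx]]] := minorant x.
  have [||y [z [Dy Dz hy hz]]] := N h (Num.max r (s - d) + b) (e / 2).
  - by rewrite -ltrBrDr hx.
  - lra.
  rewrite ltNge => /negP; apply; move: hy hz; rewrite -!ltrBrDr => hy hz.
  have hyz : Num.max r (s - d) < h (2^-1 *: (y + z)) - b.
    by rewrite dual_fun_midpoint; lra.
  apply: close; try exact: DC.
  - by apply: le_lt_trans (lt_le_trans hy (hq y)); rewrite le_max lexx.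
  - by apply: le_lt_trans (lt_le_trans hz (hq z)); rewrite le_max lexx.
  have := lt_le_trans hyz (hq _); rewrite qmid gt_max => /andP[_].
  by have := Ds y Dy; have := Ds z Dz; lra.
have iterC n : iter n (dent_deriv e) C `<=` C.
  by elim: n => // n IH x /dent_deriv_sub /IH.
have bound n x : iter n (dent_deriv e) C x -> q x <= Num.max r (rho - d *+ n).
  elim: n x => [|n IH] x; first by rewrite mulr0n subr0 le_max => /Crho ->; rewrite orbT.
  have [rn|rn] := leP r (rho - d *+ n).
    rewrite (max_r rn) in IH; move=> /(step _ _ (iterC n) IH).
    by rewrite mulrSr opprD addrA.
  rewrite (max_l (ltW rn)) in IH; move=> /dent_deriv_sub /IH qx.
  by rewrite le_max qx.
exists (Num.truncn ((rho - r) / d)).+1 => x /bound.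
have := truncnS_gt ((rho - r) / d).
rewrite ltr_pdivrMr// mulrC mulr_natr => H.
by rewrite max_l//; lra.
Qed.

(** * Dentability index of the unit ball *)

Local Notation B := [set x : X | `|x| <= 1].

Lemma unit_ball_midpoint : midpoint_closed B.
Proof.
move=> x y /= x1 y1; rewrite normrZ ger0_norm ?invr_ge0//.
by rewrite ler_pdivrMl// mulr1 (le_trans (ler_normD _ _))//; lra.
Qed.

Lemma dent_iter_center e a : dent_iter e B a !=set0 -> dent_iter e B a 0.
Proof.
case=> x Bx; rewrite -(scaler0 _ (2^-1)) -(subrr x).
apply: dent_iter_midpoint => //; first exact: unit_ball_midpoint.
have := @dent_iter_affine e B B a 0 (-1) _ _ x Bx.
rewrite normrN1 mul1r add0r scaleN1r; apply; first by rewrite oppr_eq0 oner_eq0.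
by move=> y /= y1; rewrite add0r scaleN1r normrN.
Qed.

(** [y / 2 + B / 2] is included in [B], and the derived set of [B / 2] for
    [e / 2] contains 0. *)
Lemma half_ball_dent_iter e a y : dent_iter e B a !=set0 -> B y ->
  dent_iter (e / 2) B a (2^-1 *: y).
Proof.
move=> /dent_iter_center B0 By.
have := @dent_iter_affine e B B a (2^-1 *: y) 2^-1 _ _ 0 B0.
rewrite scaler0 addr0 ger0_norm ?invr_ge0// mulrC; apply.
  by rewrite invr_eq0.
by move=> x Bx; rewrite -scalerDr; exact: unit_ball_midpoint.
Qed.

(** The first derivation leaves at least [B / 2], and the other [k] ones act on
    [B / 2] for half of the parameter that they need on [B]. *)
Lemma iter_dent_iter_neq0 e a k : 0 < e -> dent_iter e B a !=set0 ->
  iter k (fun D => dent_iter (e / 2 ^+ k) D a) B 0.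
Proof.
move=> e0 Ba; elim: k => [|k IH]; first by rewrite /= normr0.
rewrite iterSr -dent_iter_mul; rewrite -dent_iter_mul in IH.
have ek : `|2^-1| * (e / 2 ^+ k) = e / 2 ^+ k.+1.
  by rewrite ger0_norm ?invr_ge0// exprS invfM mulrCA.
have := @dent_iter_affine _ _ (dent_iter (e / 2 ^+ k.+1) B a) _ 0 2^-1 _ _ 0 IH.
rewrite scaler0 addr0 ek; apply; first by rewrite invr_eq0.
move=> x Bx; rewrite add0r; apply: dent_iter_anti_eps (half_ball_dent_iter Ba Bx).
rewrite ler_pM2l// lef_pV2 ?posrE ?exprn_gt0//.
by rewrite -{1}[2]expr1 ler_eXn2l ?ltr1n.
Qed.

Lemma xord_le_trans (a b c : xord) : xord_le a b -> xord_le b c -> xord_le a c.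
Proof. by case: a b c => [a|] [b|] [c|] //=; exact: ord_le_trans. Qed.

Lemma dent_index_ge_iter e a : 0 < e -> dent_iter e B a !=set0 ->
  xord_le (XFin a) (dent_index X).
Proof.
move=> e0 [x Bx].
apply: (@xord_le_trans _ (dent_index_eps X e)).
  apply/xord_infP => b /= Bb; case: (ord_total a b) => // /ord_leS ba.
  by have := dent_iter_anti ba Bx; rewrite Bb.
have := (xord_supP (exist (fun e : R => 0 < e) 1 ltr01)
  (fun u => dent_index_eps X (sval u)) (dent_index X)).1.
move/(_ _ (exist (fun e : R => 0 < e) e e0)); apply; rewrite -/(dent_index X).
by case: (dent_index X) => //= b; exact: ord_lexx.
Qed.

Lemma dent_index_le a : (forall e, 0 < e -> dent_iter e B a = set0) ->
  xord_le (dent_index X) (XFin a).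
Proof.
move=> H; apply/xord_supP => -[e e0] /=.
have := (xord_infP [set a | dent_iter e B a = set0] (dent_index_eps X e)).1.
apply; last exact: H.
by rewrite -/(dent_index_eps X e); case: dent_index_eps => //= b; exact: ord_lexx.
Qed.

Lemma dent_index_ge_exp e n : 0 < e ->
  dent_iter e B (ord_exp ord_omega n) !=set0 ->
  xord_le (XFin (ord_exp ord_omega n.+1)) (dent_index X).
Proof.
move=> e0 Bn; have H k : xord_le
    (XFin (ord_mul (ord_exp ord_omega n) (iter k OSucc OZero))) (dent_index X).
  apply: (@dent_index_ge_iter (e / 2 ^+ k)); first by rewrite divr_gt0// exprn_gt0.
  by exists 0; rewrite dent_iter_mul; exact: iter_dent_iter_neq0.
rewrite /ord_exp iterS -/(ord_exp _ n) /ord_omega /=.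
by case: dent_index H => //= b H k; exact: H.
Qed.

(** Either the derived set of order [omega ^ n] is nonempty for some [e], and then
    the next power is reached, or [omega ^ n] is itself an upper bound. *)
Lemma dent_index_dichotomy n :
  xord_le (XFin (ord_exp ord_omega n)) (dent_index X) ->
  xord_le (dent_index X) (XFin (ord_exp ord_omega n.+1)) ->
  xord_eq (dent_index X) (XFin (ord_exp ord_omega n)) \/
  xord_eq (dent_index X) (XFin (ord_exp ord_omega n.+1)).
Proof.
move=> ge le.
have [[e [e0 Be]]|/forallNP H] :=
    pselect (exists e, 0 < e /\ dent_iter e B (ord_exp ord_omega n) !=set0).
  by right; split=> //; exact: dent_index_ge_exp Be.
left; split=> //; apply: dent_index_le => e e0.
by apply: contrapT => /eqP/set0P Be; apply: (H e).
Qed.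

(** The mean of the [T i] with [k * 2 ^ n <= i < k.+1 * 2 ^ n], written so that the
    family is a dyadic tree by definition. *)
Fixpoint dyadic_mean (T : nat -> X) n k : X :=
  if n is n'.+1 then 2^-1 *: (dyadic_mean T n' k.*2 + dyadic_mean T n' k.*2.+1)
  else T k.

Lemma dyadic_mean_const T n k (f : dual X) (b : R) :
  (forall i, i %/ 2 ^ n = k -> f (T i) = b)%N -> f (dyadic_mean T n k) = b.
Proof.
elim: n k => [|n IH] k H /=; first by rewrite H// divn1.
rewrite dual_fun_midpoint !IH; first by lra.
  by move=> i ik; apply: H; rewrite expnSr divnMA ik divn2; exact: (half_bit_double k true).
by move=> i ik; apply: H; rewrite expnSr divnMA ik divn2; exact: (half_bit_double k false).
Qed.

(** The vertices [dyadic_mean T n k] of level [n] survive [n] derivations, so 0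
    survives all finite numbers of them, and the derived set of order [omega]
    is not empty. *)
Lemma dent_index_ge_tree e (T : nat -> X) : 0 < e ->
  (forall i, `|T i| <= 1) ->
  (forall n k, 2 * e <= `|dyadic_mean T n k.*2 - dyadic_mean T n k.*2.+1|) ->
  xord_le (XFin (ord_exp ord_omega 2)) (dent_index X).
Proof.
move=> e0 T1 Te.
have BT n k : iter n (dent_deriv e) B (dyadic_mean T n k).
  elim: n k => [k|n IH k] /=; first exact: T1.
  apply: dent_deriv_midpoint => //.
  have := @dent_iter_midpoint e B (iter n OSucc OZero) unit_ball_midpoint.
  suff -> : dent_iter e B (iter n OSucc OZero) = iter n (dent_deriv e) B by [].
  by elim: n {IH} => //= n ->.
apply: (@dent_index_ge_exp e 1) => //; exists 0.
rewrite dent_iter_exp => n _.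
have E : iter n (fun D => dent_iter e D (ord_exp ord_omega 0)) B =
    dent_iter e B (iter n OSucc OZero).
  by elim: n => //= n ->.
rewrite E; apply: dent_iter_center; exists (dyadic_mean T n 0).
by have := BT n 0%N; move: (dyadic_mean T n 0); rewrite -E.
Qed.
End Derivation.

(** * Lipschitz functions and their action on the free space *)

Section LipFun.
Context (R : realType) (M : metricType R).

Lemma lipschitz_const_max (F G : M -> R) k : lipschitz_const F k ->
  lipschitz_const G k -> lipschitz_const (fun z => Num.max (F z) (G z)) k.
Proof.
move=> [k0 Fk] [_ Gk]; split=> // x y; have := Fk x y; have := Gk x y.
by rewrite !ler_norml; case: (leP (F x)); case: (leP (F y)); lra.
Qed.

Lemma lipschitz_constN (F : M -> R) k : lipschitz_const F k ->
  lipschitz_const (fun z => - F z) k.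
Proof. by move=> [k0 Fk]; split=> // x y; rewrite -opprD normrN. Qed.

Lemma lipschitz_const_min (F G : M -> R) k : lipschitz_const F k ->
  lipschitz_const G k -> lipschitz_const (fun z => Num.min (F z) (G z)) k.
Proof.
move=> [k0 Fk] [_ Gk]; split=> // x y; have := Fk x y; have := Gk x y.
by rewrite !ler_norml; case: (leP (F x)); case: (leP (F y)); lra.
Qed.

Lemma lipschitz_const_cst (b : R) k : 0 <= k -> lipschitz_const (fun _ : M => b) k.
Proof.
by move=> k0; split=> // x y; rewrite subrr normr0 mulr_ge0// mdist_ge0.
Qed.

Lemma lipschitz_const_cone (b : R) (p : M) :
  lipschitz_const (fun z => b - mdist z p) 1.
Proof.
split=> // x y; rewrite mul1r ler_norml.
have := metric_triangle y x p; have := metric_triangle x y p.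
by rewrite (metric_sym y x); lra.
Qed.
End LipFun.

Section Free.
Context (R : realType) (M : metricType R) (o : M).
Local Notation X := (lipschitz_free o).
Local Notation pt := (free_val (o:=o)).
Implicit Types (x : X) (f g h : Lip0 o) (y z : M).

Lemma Lip0_exists (F : M -> R) k : F o = 0 -> lipschitz_const F k ->
  exists2 g : Lip0 o, (forall z, g z = F z) & `|g| <= k.
Proof.
move=> Fo Fk; have FP : F \in @Lip0_pred R M o by rewrite inE; split=> //; exists k.
by exists (MkLip0 FP) => //; apply: Lip0_norm_le.
Qed.

Lemma Lip0_addE f g z : (f + g) z = f z + g z.
Proof. by []. Qed.

Lemma Lip0_oppE f z : (- f) z = - f z.
Proof. by []. Qed.

Lemma Lip0_scaleE (k : R) f z : (k *: f) z = k * f z.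
Proof. by []. Qed.

Lemma Lip0P g : lipschitz_const g `|g|.
Proof. exact: Lip0_normP. Qed.

Lemma Lip0_lip1 g y z : `|g| <= 1 -> `|g y - g z| <= mdist y z.
Proof.
move=> g1; have [_ /(_ y z) H] := Lip0P g; apply: le_trans H _.
by rewrite ler_piMl// mdist_ge0.
Qed.

Lemma Lip0_abs1 g z : `|g| <= 1 -> `|g z| <= mdist z o.
Proof. by move=> g1; have := Lip0_lip1 z o g1; rewrite Lip0_base subr0. Qed.

Lemma free_norm_ge x g : `|pt x g| <= `|x| * `|g|.
Proof. exact: le_dual_norm. Qed.

Lemma free_norm_le x c : 0 <= c -> (forall g, `|g| <= 1 -> pt x g <= c) -> `|x| <= c.
Proof.
move=> c0 H; apply: ge_sup; first by exists `|pt x 0|, 0 => //=; rewrite normr0.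
move=> _ [g /= g1 <-]; rewrite ler_norml H// andbT lerNl.
by rewrite -mulN1r -(dual_funZ (pt x)) scaleN1r H// normrN.
Qed.

Lemma free_eval_subproof g : (fun x : X => pt x g) \in @dual_pred R X.
Proof. by apply: (@dual_bounded_fun _ _ _ `|g|) => // x; rewrite mulrC free_norm_ge. Qed.

Definition free_eval g : dual X := Dual (free_eval_subproof g).

Lemma free_finite_approx x (e : R) : 0 < e -> exists (w : dual (Lip0 o)) (s : seq M),
  `|pt x - w| < e /\ forall f g, {in s, f =1 g} -> w f = w g.
Proof.
move=> e0; have /set_mem cx : pt x \in free_pred (o:=o) by case: x.
have [w [[n [c [d [dd wE]]]] xw]] := cx _ (nbhsx_ballx (pt x) e e0).
have /choice[p pE] : forall i, exists z, delta o z = d i.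
  by move=> i; have [z _ zE] := dd i; exists z.
exists w, [seq p i | i <- enum 'I_n]; split; first by move: xw; rewrite -ball_normE.
move=> f g fg; rewrite wE !dual_sumE; apply: eq_bigr => i _.
have E h : (c i *: d i) h = c i * h (p i) by rewrite -pE.
by rewrite !E; congr (_ * _); apply: fg; apply: map_f; rewrite mem_enum.
Qed.

(** Combinations of evaluations are dense, so a strict lower bound of [pt x h]
    is already witnessed on finitely many points: [h] may be replaced by any
    function of bounded norm with the same values there. *)
Lemma free_gt_local x h (K t : R) : `|h| <= K -> t < pt x h ->
  exists s : seq M, forall f, `|f| <= K -> {in s, f =1 h} -> t < pt x f.
Proof.
move=> hK th; have K0 : 0 <= K := le_trans (normr_ge0 _) hK.
have [|w [s [xw ws]]] := @free_finite_approx x ((pt x h - t) / (2 * K + 1)).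
  by rewrite divr_gt0; lra.
exists s => f fK fh; have wfh := ws _ _ fh.
have wx g : `|g| <= K -> `|pt x g - w g| <= `|pt x - w| * K.
  move=> gK; apply: le_trans (le_dual_norm (pt x - w) g) _.
  by apply: ler_wpM2l gK; exact: dual_norm_ge0.
have := wx _ hK; have := wx _ fK; rewrite wfh !ler_norml.
have : `|pt x - w| * (2 * K + 1) < pt x h - t by rewrite -ltr_pdivlMr//; lra.
have := normr_ge0 (pt x - w); nra.
Qed.

Lemma seq_radius (t : seq M) :
  exists2 rho : R, 0 < rho & forall z, z \in t -> 2 * mdist z o <= rho.
Proof.
elim: t => [|z t [rho rho0 IH]]; first by exists 1.
exists (Num.max rho (2 * mdist z o)); first by rewrite lt_max rho0.
by move=> y; rewrite inE le_max => /orP[/eqP ->|/IH ->]; rewrite ?lexx ?orbT.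
Qed.

(** Clamping [h] between [- b] and [b], where [b z] is the positive part of
    [r - mdist z o], keeps [h] on the ball of radius [r / 2], because
    [`|h z| <= mdist z o] there; unlike multiplication by a cut-off function, it
    does not increase the Lipschitz constant. *)
Lemma Lip0_truncate h r : 0 <= r -> `|h| <= 1 -> exists2 g : Lip0 o, `|g| <= 1 &
  [/\ forall z, 2 * mdist z o <= r -> g z = h z,
      forall z, r <= mdist z o -> g z = 0 & forall z, `|g z| <= r].
Proof.
move=> r0 h1; pose b z := Num.max 0 (r - mdist z o).
have bb : lipschitz_const b 1.
  apply: lipschitz_const_max; first exact: lipschitz_const_cst.
  exact: lipschitz_const_cone.
have [||g gE g1] := @Lip0_exists (fun z => Num.max (- b z) (Num.min (h z) (b z))) 1.
- rewrite /b mdistxx subr0 Lip0_base (max_r r0) min_l// max_r//; lra.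
- apply: lipschitz_const_max; first exact: lipschitz_constN.
  apply: lipschitz_const_min => //; split=> // y z.
  by rewrite mul1r Lip0_lip1.
exists g => //; split=> z; rewrite gE /b.
- move=> zr; have := Lip0_abs1 z h1; rewrite ler_norml => /andP[h2 h3].
  by have := mdist_ge0 z o => ?; rewrite (@max_r _ _ 0) ?min_l ?max_r; lra.
- by move=> zr; rewrite (@max_l _ _ 0); last lra; rewrite oppr0 max_l// ge_min lexx orbT.
- have b0 : 0 <= b z by rewrite le_max lexx.
  have br : b z <= r by rewrite ge_max r0 /= lerBlDr lerDl mdist_ge0.
  rewrite -/(b z) ler_norml le_max ge_max ge_min lerN2 br orbT andbT /=; lra.
Qed.

(** If [y] is in the support of [f] and [z] in that of [g], then [mdist z o]
    exceeds [K] times [mdist y o], and the jump is at most the sum of these two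
    numbers, while [mdist y z] is at least their difference. *)
Lemma Lip0_glue f g (r K d : R) : 0 <= r -> 0 < d -> K = 1 + 2 / d ->
  `|f| <= 1 -> `|g| <= 1 ->
  (forall z, r <= mdist z o -> f z = 0) ->
  (forall z, mdist z o <= K * r -> g z = 0) -> `|f + g| <= 1 + d.
Proof.
move=> r0 d0 KE f1 g1 fr gK; apply: Lip0_norm_le.
have dK : d * K = d + 2 by rewrite KE; field; lra.
have K1 : 1 <= K by rewrite KE; have : 0 < 2 / d by [rewrite divr_gt0]; lra.
have rK : r <= K * r by rewrite ler_peMl.
split=> [|y z]; first lra.
rewrite !Lip0_addE.
wlog yz : y z / mdist y o <= mdist z o => [H|].
  have [yz|/ltW yz] := leP (mdist y o) (mdist z o); first exact: H.
  by rewrite distrC metric_sym H.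
have dyz := mdist_ge0 y z.
apply: (@le_trans _ _ ((1 + d) * mdist y z)); last by [].
have le1 : mdist y z <= (1 + d) * mdist y z by rewrite ler_peMl//; lra.
have [yr|yr] := leP r (mdist y o).
  rewrite (fr y)// (fr z) ?(le_trans yr)// !add0r.
  exact: le_trans (Lip0_lip1 _ _ g1) le1.
rewrite (gK y) ?(le_trans (ltW yr))// addr0.
have [zr|zr] := leP (mdist z o) (K * r).
  by rewrite (gK z)// addr0; exact: le_trans (Lip0_lip1 _ _ f1) le1.
rewrite (fr z) ?(le_trans rK) ?(ltW zr)// add0r.
apply: le_trans (ler_normB _ _) _.
apply: le_trans (lerD (Lip0_abs1 y f1) (Lip0_abs1 z g1)) _.
have := metric_triangle z y o; rewrite (metric_sym z y) => tri.
have : d * K * mdist y o <= d * mdist z o.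
  rewrite -mulrA; apply: (ler_wpM2l (ltW d0)); apply: le_trans _ (ltW zr).
  by apply: ler_wpM2l; [lra|exact: ltW].
by rewrite dK; nra.
Qed.

(** * Uniformly discrete spaces: coordinates *)

Section Discrete.
Context (a : R) (a0 : 0 < a) (Ma : forall x y : M, x <> y -> a <= mdist x y).

(** The only place where uniform discreteness enters the upper bound: bounded
    functions are Lipschitz. *)
Lemma lipschitz_const_bounded (F : M -> R) b : (forall z, `|F z| <= b) ->
  lipschitz_const F (b * (2 / a)).
Proof.
move=> Fb; have b0 : 0 <= b := le_trans (normr_ge0 _) (Fb o).
split=> [|y z]; first by rewrite mulr_ge0// divr_ge0// ltW.
have [->|/eqP yz] := eqVneq y z; first by rewrite subrr normr0 mdistxx mulr0.
apply: le_trans (ler_normB _ _) _; apply: le_trans (lerD (Fb y) (Fb z)) _.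
rewrite -mulrA [leLHS](_ : _ = b * 2); last by ring.
rewrite ler_wpM2l// -mulrA ler_pMr// mulrC ler_pdivlMr// mul1r.
exact: Ma.
Qed.

Lemma Lip0_norm_bounded g b : (forall z, `|g z| <= b) -> `|g| <= b * (2 / a).
Proof. by move=> gb; apply: Lip0_norm_le; exact: lipschitz_const_bounded. Qed.

(** Elements of [Lip0 o] vanish at [o], hence the indicator of [o] is replaced
    by 0. *)
Lemma Lip0_indic_exists z : exists g, forall y, g y = ((y == z) && (z != o))%:R.
Proof.
have [||g gE _] := @Lip0_exists (fun y => ((y == z) && (z != o))%:R) (1 * (2 / a)).
- by rewrite eq_sym andbN.
- by apply: lipschitz_const_bounded => y; case: (_ && _); rewrite ?normr1 ?normr0.
by exists g.
Qed.

Definition Lip0_indic z : Lip0 o := sval (cid (Lip0_indic_exists z)).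

Lemma Lip0_indicE z y : Lip0_indic z y = ((y == z) && (z != o))%:R.
Proof. by rewrite /Lip0_indic; case: cid. Qed.

Lemma Lip0_indic_norm z : `|Lip0_indic z| <= 2 / a.
Proof.
rewrite -[leRHS]mul1r; apply: Lip0_norm_bounded => y; rewrite Lip0_indicE.
by case: (_ && _); rewrite ?normr1 ?normr0.
Qed.

Definition Lip0_restr (s : seq M) g : Lip0 o :=
  \sum_(z <- undup s) g z *: Lip0_indic z.

Lemma Lip0_sumE (I : Type) (s : seq I) (F : I -> Lip0 o) z :
  (\sum_(i <- s) F i) z = \sum_(i <- s) F i z.
Proof. by elim/big_rec2 : _ => // i b c _ <-. Qed.

Lemma Lip0_restrE s g z : Lip0_restr s g z = if z \in s then g z else 0.
Proof.
have [->|zo] := eqVneq z o; first by rewrite !Lip0_base if_same.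
rewrite /Lip0_restr Lip0_sumE -mem_undup.
under eq_bigr => y _.
  rewrite Lip0_scaleE Lip0_indicE; over.
case: ifPn => zs.
  rewrite (bigD1_seq z)//= ?undup_uniq// eqxx zo mulr1 big1_seq ?addr0// => y.
  by case/andP=> yz _; rewrite eq_sym (negbTE yz) mulr0.
rewrite big1_seq// => y /andP[_ ys]; case: eqP => [zy|_]; last by rewrite mulr0.
by rewrite zy ys in zs.
Qed.

Lemma free_restrE x (s : seq M) g :
  pt x (Lip0_restr s g) = \sum_(z <- undup s) g z * pt x (Lip0_indic z).
Proof.
rewrite /Lip0_restr; elim: (undup s) => [|z t IH].
  by rewrite !big_nil (dual_fun0 (pt x)).
by rewrite !big_cons (dual_funD (pt x)) (dual_funZ (pt x)) IH.
Qed.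

Lemma free_restr_le x (s : seq M) g (b t : R) : (forall z, `|g z| <= b) ->
  (forall z, z \in s -> `|pt x (Lip0_indic z)| <= t) ->
  pt x (Lip0_restr s g) <= (size (undup s))%:R * (b * t).
Proof.
move=> gb xt; rewrite free_restrE mulr_natl -iter_addr_0 -count_predT -big_const_seq.
rewrite big_seq [leRHS]big_seq; apply: ler_sum => z; rewrite mem_undup => zs.
apply: le_trans (ler_norm _) _; rewrite normrM.
by apply: ler_pM => //; exact: xt.
Qed.

Lemma coord_sqr_le x (s : seq M) : `|x| <= 1 ->
  \sum_(z <- undup s) (pt x (Lip0_indic z)) ^+ 2 <=
  (size (undup s))%:R * (2 / a) ^+ 2.
Proof.
move=> x1; rewrite mulr_natl -iter_addr_0 -count_predT -big_const_seq.
apply: ler_sum => z _.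
rewrite -real_normK ?num_real// ler_sqr ?nnegrE ?divr_ge0 ?(ltW a0)//.
apply: le_trans (free_norm_ge _ _) _; rewrite -[leRHS]mul1r.
by rewrite ler_pM// Lip0_indic_norm.
Qed.

Lemma free_subE x (y : X) f : pt (x - y) f = pt x f - pt y f.
Proof. by []. Qed.

(** * The upper bound *)

Section Epsilon.
Context (e d K : R) (e0 : 0 < e) (d0 : 0 < d) (de : 36 * d = e) (KE : K = 1 + 2 / d).

Local Notation D1 C := (\bigcap_n iter n (dent_deriv e) C).

(** The supremum of [pt x g] over these [g] is the [l_1] norm of the part of [x]
    on the open ball of radius [r], the point [o] excepted. *)
Definition sup_unit_in_ball (r : R) g :=
  (forall z, `|g z| <= 1) /\ (forall z, r <= mdist z o -> g z = 0).

(** In [l_1], what [f] sees of [x] and what lies far away from [f] add up. *)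
Lemma free_tail x f g (rho s : R) : 0 <= rho -> s <= 1 -> `|x| <= s ->
  `|f| <= 1 -> (forall z, rho <= mdist z o -> f z = 0) ->
  `|g| <= 1 -> (forall z, mdist z o <= K * rho -> g z = 0) ->
  pt x f + pt x g <= s + d.
Proof.
move=> rho0 s1 xs f1 fr g1 gK.
have := free_norm_ge x (f + g); rewrite (dual_funD (pt x)) => H.
apply: le_trans (ler_norm _) _; apply: le_trans H _.
apply: le_trans (ler_wpM2l (normr_ge0 x) (Lip0_glue rho0 d0 KE f1 g1 fr gK)) _.
rewrite mulrDr mulr1 lerD// ler_piMl//; [exact: ltW|exact: le_trans xs s1].
Qed.

(** [pt x f] and [pt y f] almost equal their upper bound [s], so by [free_tail]
    neither [x] nor [y] has much mass beyond radius [K * rho].  Testing [x - y]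
    against a function [h], truncated at radius [2 * K * rho], leaves twice a
    1-Lipschitz function that vanishes within radius [K * rho], and at this
    function [x] and [- y] are at most [4 * d]. *)
Lemma norm_sub_le_near x (y : X) f (rho s b : R) : 0 < rho -> s <= 1 ->
  `|f| <= 1 -> (forall z, rho <= mdist z o -> f z = 0) ->
  `|x| <= s -> `|y| <= s -> s - 3 * d <= pt x f -> s - 3 * d <= pt y f -> 0 <= b ->
  (forall h, (forall z, `|h z| <= 2 * K * rho) ->
     (forall z, 2 * K * rho <= mdist z o -> h z = 0) -> pt (x - y) h <= b) ->
  `|x - y| <= 16 * d + b.
Proof.
move=> rho0 s1 f1 fr xs ys xf yf b0 H.
apply: free_norm_le => [|h h1]. 
  by rewrite addr_ge0 ?mulr_ge0// ltW.
have K1 : 1 <= K by rewrite KE; have : 0 < 2 / d by [rewrite divr_gt0]; lra.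
have Kr : 0 <= 2 * K * rho by rewrite !mulr_ge0//; lra.
have [h' h'1 [h'h h'0 h'b]] := Lip0_truncate Kr h1.
pose g := 2^-1 *: (h - h').
have g1 : `|g| <= 1.
  rewrite normrZ ger0_norm ?invr_ge0// ler_pdivrMl// mulr1.
  by rewrite (le_trans (ler_normB _ _))//; lra.
have gK z : mdist z o <= K * rho -> g z = 0.
  move=> zK; rewrite /g Lip0_scaleE Lip0_addE Lip0_oppE h'h ?subrr ?mulr0//.
  by rewrite -mulrA ler_pM2l.
have ng1 : `|- g| <= 1 by rewrite normrN.
have ngK z : mdist z o <= K * rho -> (- g) z = 0.
  by move=> zK; rewrite Lip0_oppE gK// oppr0.
have xg := free_tail (ltW rho0) s1 xs f1 fr g1 gK.
have yg := free_tail (ltW rho0) s1 ys f1 fr ng1 ngK.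
have -> : h = h' + 2 *: g by rewrite /g scalerA divff// scale1r addrC subrK.
rewrite (dual_funD (pt (x - y))) (dual_funZ (pt (x - y))).
have := H h' h'b h'0; rewrite !free_subE.
move: yg; rewrite (dual_funN (pt y)).
lra.
Qed.

(** Suppose that [pt x f + k * pt x g] exceeds [r].  By density one may restrict
    [g] to a finite set [t]; let [g'] be the restriction.  [l] is the functional
    [f + k * g'], and [iter_dent_deriv_quadratic_le] is applied to [l] plus [k']
    times the squares of the coordinates in [t], with [k'] so small that this
    sum of squares is negligible.  If the resulting function exceeds [r] at [y],
    then
    - [pt y f] is almost equal to its upper bound [s] ([lf]), as [k * (2 / a) <= d];
    - adding to [g'] a function supported off [t] gains nearly nothing, as the
      gain is limited by the assumption on [C] ([lh]).
    So for two such points [y] and [z] that are close on the coordinates in [t],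
    [norm_sub_le_near] applies: a function supported in the ball splits into
    its restriction to [t] and a multiple of some [p] to which the second item
    applies. *)
Lemma D1_perturbed_functional_le (C : set X) f (rho s k r : R) :
  0 < rho -> s <= 1 -> 0 < k -> k * (2 / a) <= d ->
  `|f| <= 1 -> (forall z, rho <= mdist z o -> f z = 0) ->
  (forall x, C x -> `|x| <= s) -> s - d <= r ->
  (forall x g, C x -> sup_unit_in_ball (2 * K * rho) g ->
     pt x f + k * pt x g <= r + k * d / (4 * (2 * K * rho))) ->
  forall x g, D1 C x -> sup_unit_in_ball (2 * K * rho) g -> pt x f + k * pt x g <= r.
Proof.
move=> rho0 s1 k0 ka f1 fr Cs sr CH x g Dx [g1 gr]; rewrite leNgt; apply/negP => xg.
have K1 : 1 <= K by rewrite KE; have : 0 < 2 / d by [rewrite divr_gt0]; lra.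
set r' := 2 * K * rho in CH gr; have r'0 : 0 < r' by rewrite !mulr_gt0//; lra.
have normb h : (forall z, `|h z| <= 1) -> `|h| <= 2 / a.
  by move=> h1; rewrite -[leRHS]mul1r; exact: Lip0_norm_bounded.
have [t tP] : exists t : seq M, forall h, `|h| <= 2 / a -> {in t, h =1 g} ->
    (r - pt x f) / k < pt x h.
  by apply: free_gt_local; [exact: normb|rewrite ltr_pdivrMr//; lra].
pose g' := Lip0_restr t g.
have g'1 z : `|g' z| <= 1 by rewrite Lip0_restrE; case: ifP; rewrite ?normr0.
have xg' : r < pt x f + k * pt x g'.
  rewrite addrC -ltrBlDr mulrC -ltr_pdivrMr//; apply: tP; first exact: normb.
  by move=> z zt; rewrite Lip0_restrE zt.
pose N : R := (size (undup t))%:R; have N0 : 0 <= N by [].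
pose L := N * (2 / a) ^+ 2; have L0 : 0 <= L by rewrite mulr_ge0// sqr_ge0.
pose m := Num.min d (k * d / (4 * r')).
have m0 : 0 < m by rewrite lt_min d0 /= divr_gt0// mulr_gt0.
pose k' : R := m / (L + 1); have k'0 : 0 < k' by rewrite divr_gt0// ltr_wpDl.
have k'L : k' * L <= m.
  by rewrite /k' mulrAC ler_pdivrMr ?ltr_wpDl// ler_pM2l// lerDl.
pose tau := d / (r' * (N + 1)).
have tau0 : 0 < tau by rewrite divr_gt0// mulr_gt0// ltr_wpDl.
pose cs := [seq free_eval (Lip0_indic z) | z <- undup t].
have csE (y : X) : \sum_(c <- cs) (c y) ^+ 2 = \sum_(z <- undup t) (pt y (Lip0_indic z)) ^+ 2.
  by rewrite big_map.
have csL (y : X) : C y -> \sum_(c <- cs) (c y) ^+ 2 <= L.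
  by move=> Cy; rewrite csE; apply: coord_sqr_le (le_trans (Cs _ Cy) s1).
have coord (u : X) z : z \in t -> \sum_(c <- cs) (c u) ^+ 2 < tau ^+ 2 ->
    `|pt u (Lip0_indic z)| <= tau.
  move=> zt; rewrite csE => /ltW H.
  rewrite -(@ler_sqr _ _ tau) ?nnegrE ?(ltW tau0)// real_normK ?num_real//.
  apply: le_trans H; rewrite (bigD1_seq z) ?mem_undup ?undup_uniq//= lerDl.
  by apply: sumr_ge0 => ? _; exact: sqr_ge0.
pose l : dual X := free_eval f + k *: free_eval g'.
have lE (y : X) : l y = pt y f + k * pt y g' by [].
have dual_le (y : X) h : C y -> (forall z, `|h z| <= 1) -> pt y h <= 2 / a.
  move=> Cy h1; apply: le_trans (ler_norm _) _.
  apply: le_trans (free_norm_ge _ _) _; rewrite -[leRHS]mul1r.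
  by rewrite ler_pM// ?normb// (le_trans (Cs _ Cy)).
have mulk' (v : R) : 0 <= v -> v <= L -> k' * v <= m.
  by move=> v0 vL; apply: le_trans k'L; rewrite ler_pM2l.
have md : m <= d by rewrite ge_min lexx.
pose del := k * d / (4 * r').
have mdel : m <= del by rewrite ge_min lexx orbT.
have k'cs (y : X) : C y -> k' * \sum_(c <- cs) (c y) ^+ 2 <= m.
  by move=> Cy; apply: mulk' (csL _ Cy); apply: sumr_ge0 => ? _; exact: sqr_ge0.
have g'ball : sup_unit_in_ball r' g'.
  by split=> // z zr; rewrite Lip0_restrE gr// if_same.
have lf (y : X) : C y -> r < l y + k' * \sum_(c <- cs) (c y) ^+ 2 -> s - 3 * d <= pt y f.
  move=> Cy qy; have := k'cs _ Cy; move: qy; rewrite lE.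
  have := ler_wpM2l (ltW k0) (dual_le _ _ Cy g'1); lra.
have lh (y : X) h : C y -> r < l y + k' * \sum_(c <- cs) (c y) ^+ 2 ->
    sup_unit_in_ball r' (g' + h) -> pt y h <= d / (2 * r').
  move=> Cy qy gh; have := k'cs _ Cy; move: qy; rewrite lE.
  have := CH _ _ Cy gh; rewrite (dual_funD (pt y)) -/del mulrDr => H1 H2 H3.
  have : k * pt y h <= k * (d / (2 * r')).
    rewrite [leRHS](_ : _ = 2 * del); last by rewrite /del; field; rewrite gt_eqF.
    lra.
  by rewrite ler_pM2l.
have [|||J] := @iter_dent_deriv_quadratic_le R X e C l cs k' r (k' * tau ^+ 2 / 4) e0 k'0 _.
- by rewrite divr_gt0// mulr_gt0// exprn_gt0.
- exists (r + del + m) => y Cy; apply: lerD (k'cs _ Cy).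
  exact: CH Cy g'ball.
- move=> y z Cy Cz qy qz; rewrite [ltRHS](_ : _ = k' * tau ^+ 2); last by field.
  rewrite ltr_pM2l// => utau.
  rewrite (_ : e / 2 = 16 * d + 2 * d); last by rewrite -de; field.
  apply: (norm_sub_le_near rho0 s1 f1 fr (Cs _ Cy) (Cs _ Cz) (lf _ Cy qy) (lf _ Cz qz)).
    by rewrite mulr_ge0// ltW.
  rewrite -/r' => h hr' h0.
  (* the part of h off t, normalised to be bounded by 1 *)
  pose p := r'^-1 *: (h - Lip0_restr t h).
  have pE v : p v = if v \in t then 0 else r'^-1 * h v.
    rewrite /p Lip0_scaleE Lip0_addE Lip0_oppE Lip0_restrE.
    by case: ifP => _; rewrite ?subrr ?mulr0 ?subr0.
  have p1 v : `|p v| <= 1.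
    rewrite pE; case: ifP => _; first by rewrite normr0.
    by rewrite normrM gtr0_norm ?invr_gt0// ler_pdivrMl// mulr1.
  have p0 v : r' <= mdist v o -> p v = 0.
    by move=> vr; rewrite pE h0// mulr0 if_same.
  have g'p (q : Lip0 o) : (forall v, q v = p v \/ q v = - p v) -> sup_unit_in_ball r' (g' + q).
    move=> qp; split=> v; rewrite Lip0_addE.
      rewrite Lip0_restrE; case: ifP => vt; last first.
        by rewrite add0r; case: (qp v) => ->; rewrite ?normrN p1.
      by case: (qp v) => ->; rewrite pE vt ?oppr0 addr0 g1.
    move=> vr; rewrite (g'ball.2 _ vr) add0r.
    by case: (qp v) => ->; rewrite p0// oppr0.
  have yp := lh _ _ Cy qy (g'p p (fun v => or_introl erefl)).
  have zp := lh _ _ Cz qz (g'p (- p) (fun v => or_intror erefl)).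
  rewrite (dual_funN (pt z)) in zp.
  have -> : h = Lip0_restr t h + r' *: p.
    by rewrite /p scalerA divff ?scale1r 1?addrC ?subrK// gt_eqF.
  rewrite (dual_funD (pt (y - z))) (dual_funZ (pt (y - z))) free_subE.
  have rp : r' * (pt y p - pt z p) <= d.
    rewrite -ler_pdivlMl// [leRHS](_ : _ = d / (2 * r') + d / (2 * r')); last by field; rewrite gt_eqF.
    by rewrite lerD.
  have rt : pt (y - z) (Lip0_restr t h) <= d.
    apply: le_trans (free_restr_le hr' (fun v vt => coord _ v vt utau)) _.
    rewrite -/N (_ : N * (r' * tau) = d * (N / (N + 1))); last first.
      by rewrite /tau; field; rewrite !gt_eqF// ltr_wpDl.
    by rewrite ler_piMr ?(ltW d0)// ler_pdivrMr ?ltr_wpDl// mul1r lerDl.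
  by rewrite (_ : 2 * d = d + d) ?lerD//; ring.
move=> /(_ x (Dx J I)) qx; have := le_lt_trans qx xg'.
rewrite lE -subr_lt0 addrAC subrr add0r ltNge => /negP; apply.
by rewrite mulr_ge0 ?(ltW k'0)//; apply: sumr_ge0 => ? _; exact: sqr_ge0.
Qed.

Lemma bigcap_iter_sub (F : set X -> set X) (C : set X) : \bigcap_n iter n F C `<=` C.
Proof. by move=> x /(_ 0%N I). Qed.

(** At the start the functionals [f + k * g] are at most [s + d] on [C]; each
    application of [D1] lowers this by [del], which depends on the radius [rho]
    but not on the current level.  The case [g = 0] is the conclusion. *)
Lemma iter_D1_functional_le (C : set X) f (rho s : R) : 0 < rho -> s <= 1 -> `|f| <= 1 ->
  (forall z, rho <= mdist z o -> f z = 0) -> (forall x, C x -> `|x| <= s) ->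
  exists J, forall x, iter J (fun D => D1 D) C x -> pt x f <= s - d.
Proof.
move=> rho0 s1 f1 fr Cs; pose k := d * a / 2.
have k0 : 0 < k by rewrite divr_gt0// mulr_gt0.
have ka : k * (2 / a) = d by rewrite /k; field; rewrite gt_eqF.
have K0 : 0 < K by rewrite KE addr_gt0// divr_gt0.
pose r' := 2 * K * rho; have r'0 : 0 < r' by rewrite !mulr_gt0.
pose del := k * d / (4 * r'); have del0 : 0 < del by rewrite divr_gt0// mulr_gt0.
have iterC n x : iter n (fun D => D1 D) C x -> C x.
  by elim: n => // n IH /bigcap_iter_sub /IH.
have bound n x g : iter n (fun D => D1 D) C x -> sup_unit_in_ball r' g ->
    pt x f + k * pt x g <= Num.max (s - d) (s + d - del *+ n).
  elim: n x g => [|n IH] x g.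
    move=> Cx [g1 _]; have x0 := normr_ge0 x.
    have xf : pt x f <= s.
      apply: le_trans (ler_norm _) _; apply: le_trans (free_norm_ge _ _) _.
      by rewrite (le_trans _ (Cs _ Cx))// ler_piMr.
    have xg : pt x g <= 2 / a.
      apply: le_trans (ler_norm _) _; apply: le_trans (free_norm_ge _ _) _.
      rewrite -[leRHS]mul1r ler_pM// ?(le_trans (Cs _ Cx))//.
      by rewrite -[leRHS]mul1r; exact: Lip0_norm_bounded.
    rewrite mulr0n subr0 le_max; apply/orP; right; apply: lerD => //.
    by rewrite -ka ler_pM2l.
  move=> /= Dx gb; apply: (D1_perturbed_functional_le rho0 s1 k0 _ f1 fr _ _ _ Dx gb).
  - by rewrite ka.
  - by move=> y /iterC; exact: Cs.
  - by rewrite le_max lexx.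
  move=> y h /IH H /H; rewrite -/del => {}H; apply: le_trans H _.
  rewrite addr_maxl ge_max !le_max; apply/andP; split; apply/orP.
    by left; rewrite lerDl ltW.
  by right; rewrite mulrSr opprD addrA subrK.
exists (Num.truncn (2 * d / del)).+1 => x /bound H.
have /H : sup_unit_in_ball r' 0 by split=> // z; rewrite ?normr0.
rewrite (dual_fun0 (pt x)) mulr0 addr0 max_l//.
have := truncnS_gt (2 * d / del); rewrite ltr_pdivrMr// [X in _ < X]mulr_natl.
lra.
Qed.

Local Notation D2 C := (\bigcap_n iter n (fun D => D1 D) C).

(** The functions supported in balls are norming, by density and truncation.
    The decrement [d], unlike [J] in the previous lemma, does not depend on the
    function. *)
Lemma D2_norm_le (C : set X) (s : R) : s <= 1 -> (forall x, C x -> `|x| <= s) ->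
  forall x, D2 C x -> `|x| <= s - d.
Proof.
move=> s1 Cs x Dx.
suff H h : `|h| <= 1 -> pt x h <= s - d.
  by apply: (free_norm_le _ H); have := H 0; rewrite normr0 (dual_fun0 (pt x)); exact.
move=> h1; rewrite leNgt; apply/negP => /(free_gt_local h1)[t tP].
have [rho rho0 trho] := seq_radius t.
have [f f1 [fh f0 _]] := Lip0_truncate (ltW rho0) h1.
have [J HJ] := iter_D1_functional_le rho0 s1 f1 f0 Cs.
have := HJ x (Dx J I); rewrite leNgt tP// => z zt.
by rewrite fh// trho.
Qed.

Lemma dent_iter_omega3 : dent_iter e [set x : X | `|x| <= 1] (ord_exp ord_omega 3) = set0.
Proof.
have E1 : (fun D : set X => dent_iter e D (ord_exp ord_omega 1)) = (fun D => D1 D).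
  by apply/funext => D; rewrite dent_iter_exp.
have E2 : (fun D : set X => dent_iter e D (ord_exp ord_omega 2)) = (fun D => D2 D).
  by apply/funext => D; rewrite dent_iter_exp E1.
rewrite dent_iter_exp E2; apply/seteqP; split=> // x Bx.
have bound n (y : X) : iter n (fun D => D2 D) [set y : X | `|y| <= 1] y -> `|y| <= 1 - d *+ n.
  elim: n y => [|n IH] y; first by rewrite mulr0n subr0.
  rewrite mulrSr opprD addrA => /=; apply: D2_norm_le => //.
  by rewrite gerBl mulrn_wge0// ltW.
have := bound _ _ (Bx (Num.truncn (1 / d)).+1 I); rewrite leNgt => /negP[].
apply: lt_le_trans (normr_ge0 x); rewrite subr_lt0.
by have := truncnS_gt (1 / d); rewrite ltr_pdivrMr// mulr_natl.
Qed.
End Epsilon.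
End Discrete.

(** * The lower bound for infinite spaces *)

Definition spread (c : R) (u : nat -> M) :=
  [/\ 0 < c <= 1, forall i, u i != o &
     forall i j, i != j -> c * mdist (u i) o <= mdist (u i) (u j)].

(** In a bounded space any new point will do, since nonzero distances are bounded
    below and distances to [o] are bounded above; in an unbounded space take a
    point that is at least twice as far from [o] as the previous ones. *)
Lemma spread_step : uniformly_discrete M -> infinite_set [set: M] ->
  exists2 c : R, 0 < c <= 1 & forall s : seq M, exists2 x : M, x != o &
    forall y, y \in s -> c * mdist x o <= mdist x y /\ c * mdist y o <= mdist x y.
Proof.
move=> [a a0 Ma] Minf.
have [[D MD]|/forallNP unb] := pselect (exists D : R, forall z : M, mdist z o <= D).
  have D0 : 0 <= D := le_trans (mdist_ge0 o o) (MD o).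
  have D1 : 0 < D + 1 by rewrite ltr_wpDl.
  exists (Num.min 1 (a / (D + 1))) => [|s].
    by rewrite lt_min ltr01 divr_gt0//= ge_min lexx.
  have [x /= xs] : exists x : M, x \notin o :: s.
    apply: contrapT => /forallNP H; apply: Minf.
    apply: sub_finite_set (finite_seq (o :: s)) => x _ /=.
    by apply: contrapT => /negP; exact: H.
  move: xs; rewrite inE negb_or => /andP[xo xs]; exists x => // y ys.
  have axy : a <= mdist x y by apply: Ma => xy; rewrite xy ys in xs.
  have le z : Num.min 1 (a / (D + 1)) * mdist z o <= mdist x y.
    apply: le_trans axy; apply: (@le_trans _ _ (a / (D + 1) * D)).
      apply: ler_pM => //; [|exact: mdist_ge0|by rewrite ge_min lexx orbT].
      by rewrite le_min ler01 divr_ge0 ?ltW.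
    by rewrite -mulrA ler_piMr ?(ltW a0)// ler_pdivrMl// mulr1 lerDl.
  by split; exact: le.
exists 2^-1 => [|s]; first by rewrite invr_gt0 ltr0n invf_le1// ler1n.
have [rho rho0 srho] := seq_radius s.
have /existsNP[x /negP] := unb rho; rewrite -ltNge => rx.
exists x => [|y /srho yr].
  by apply: contraTneq rx => ->; rewrite mdistxx -leNgt ltW.
have := metric_triangle x y o; have := mdist_ge0 y o; lra.
Qed.

Lemma spread_exists : uniformly_discrete M -> infinite_set [set: M] ->
  exists c u, spread c u.
Proof.
move=> Md Minf; have [c c01 H] := spread_step Md Minf.
have /choice[P HP] : forall s : seq M, exists x : M, x != o /\
    forall y, y \in s -> c * mdist x o <= mdist x y /\ c * mdist y o <= mdist x y.
  by move=> s; have [x xo xs] := H s; exists x.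
pose L n := iter n (fun s => P s :: s) [::]; pose u n := P (L n).
have uL i j : (i < j)%N -> u i \in L j.
  elim: j => // j IH; rewrite ltnS leq_eqVlt /= inE => /orP[/eqP ->|/IH ->].
    by rewrite eqxx.
  by rewrite orbT.
exists c, u; split=> // [i|i j ij]; first exact: (HP _).1.
have [ij'|ji|/eqP ij'] := ltngtP i j; last by rewrite ij' in ij.
  by rewrite (metric_sym (u i) (u j)); have [] := (HP (L j)).2 _ (uL _ _ ij').
by have [] := (HP (L i)).2 _ (uL _ _ ji).
Qed.

Lemma delta_free (z : M) : delta o z \in free_pred (o:=o).
Proof.
rewrite inE; apply: subset_closure; exists 1%N, (fun=> 1), (fun=> delta o z).
by split=> [i|]; [exists z|rewrite big_ord1 scale1r].
Qed.

Definition molecule z : X := (mdist z o)^-1 *: LipFree (delta_free z).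

Lemma moleculeE z f : pt (molecule z) f = (mdist z o)^-1 * f z.
Proof. by []. Qed.

Lemma molecule_norm z : `|molecule z| <= 1.
Proof.
apply: free_norm_le => // f f1; rewrite moleculeE.
have [->|zo] := eqVneq z o; first by rewrite Lip0_base mulr0.
rewrite ler_pdivrMl ?mdist_gt0// mulr1.
by apply: le_trans (ler_norm _) _; exact: Lip0_abs1.
Qed.

Lemma mem_iota_div q m i : (0 < q)%N ->
  (i \in iota (m * q) q) = (i %/ q == m)%N.
Proof.
move=> q0; rewrite mem_iota -mulSnr -ltn_divLR// ltnS -leq_divRL//.
by rewrite andbC -eqn_leq.
Qed.

(** The maximum of the cones of height [c * mdist (u i) o] at the [u i], for [i]
    among the indices of the first mean, takes the value [c] on the molecules of
    the first mean and 0 on those of the second one. *)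
Lemma dyadic_mean_spread c u n k : spread c u ->
  c <= `|dyadic_mean (molecule \o u) n k.*2 - dyadic_mean (molecule \o u) n k.*2.+1|.
Proof.
move=> [/andP[c0 c1] uo uc].
pose I := iota (k.*2 * 2 ^ n) (2 ^ n).
pose F z := \big[Num.max/0]_(i <- I) (c * mdist (u i) o - mdist z (u i)).
have F_max z i : i \in I -> c * mdist (u i) o - mdist z (u i) <= F z.
  by move=> iI; exact: (@le_bigmax_seq _ _ _ _ _ i).
have F_le z (b : R) : 0 <= b ->
    (forall i, i \in I -> c * mdist (u i) o - mdist z (u i) <= b) -> F z <= b.
  by move=> b0 H; rewrite /F big_seq; exact: bigmax_le.
have F0 z : 0 <= F z by exact: bigmax_ge_id.
have [||f fE f1] := @Lip0_exists F 1.
- apply/eqP; rewrite eq_le F0 andbT; apply: F_le => // i _.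
  by rewrite (metric_sym o) subr_le0 ler_piMl// mdist_ge0.
- rewrite /F; elim: I {F F_max F_le F0} => [|i s IH].
    by under eq_fun do rewrite big_nil; exact: lipschitz_const_cst.
  under eq_fun do rewrite big_cons.
  by apply: lipschitz_const_max IH; exact: lipschitz_const_cone.
have uI j : (j %/ 2 ^ n = k.*2)%N -> free_eval f (molecule (u j)) = c.
  move=> jk; have jI : j \in I by rewrite mem_iota_div ?expn_gt0// jk.
  rewrite [LHS](moleculeE (u j) f) fE (_ : F (u j) = c * mdist (u j) o).
    by rewrite mulrCA mulVf ?mulr1// gt_eqF// mdist_gt0.
  apply/eqP; rewrite eq_le; apply/andP; split; last first.
    by have := F_max (u j) j jI; rewrite mdistxx subr0.
  apply: F_le => [|i iI]; first by rewrite mulr_ge0 ?(ltW c0)// mdist_ge0.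
  have [<-|ij] := eqVneq i j; first by rewrite mdistxx subr0.
  rewrite (@le_trans _ _ 0) ?mulr_ge0 ?(ltW c0) ?mdist_ge0//.
  by rewrite subr_le0 (metric_sym (u j)) uc.
have uNI j : (j %/ 2 ^ n = k.*2.+1)%N -> free_eval f (molecule (u j)) = 0.
  move=> jk; rewrite [LHS](moleculeE (u j) f) fE (_ : F (u j) = 0) ?mulr0//.
  apply/eqP; rewrite eq_le F0 andbT; apply: F_le => // i iI.
  have ij : i != j.
    apply: contraTneq iI => ->; rewrite mem_iota_div ?expn_gt0// jk.
    by rewrite gtn_eqF.
  by rewrite subr_le0 (metric_sym (u j)) uc.
have := free_norm_ge (dyadic_mean (molecule \o u) n k.*2 - dyadic_mean (molecule \o u) n k.*2.+1) f.
rewrite -[pt _ f]/(free_eval f _) dual_funB (dyadic_mean_const uI) (dyadic_mean_const uNI).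
rewrite subr0 => H; apply: le_trans (ler_norm c) _; apply: le_trans H _.
by rewrite ler_piMr.
Qed.
End Free.

Theorem proposition3p9 (R : realType) (M : metricType R) (o : M) :
  uniformly_discrete M ->
  xord_le (dent_index (lipschitz_free o)) (XFin (ord_exp ord_omega 3)) /\
  (infinite_set [set: M] ->
   xord_eq (dent_index (lipschitz_free o)) (XFin (ord_exp ord_omega 2)) \/
   xord_eq (dent_index (lipschitz_free o)) (XFin (ord_exp ord_omega 3))).
Proof.
move=> Md; have [a a0 Ma] := Md.
have le3 : xord_le (dent_index (lipschitz_free o)) (XFin (ord_exp ord_omega 3)).
  apply: dent_index_le => e e0.
  apply: (@dent_iter_omega3 R M o a a0 Ma e (e / 36) (1 + 2 / (e / 36)) e0) => //.
    by rewrite divr_gt0.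
  by rewrite mulrC divfK.
split=> // Minf; apply: dent_index_dichotomy le3.
have [c [u cu]] := spread_exists o Md Minf.
have [/andP[c0 _] _ _] := cu.
apply: (@dent_index_ge_tree _ _ (c / 2) (molecule o \o u)).
- by rewrite divr_gt0.
- by move=> i; exact: molecule_norm.
- by move=> n k; rewrite mulrC divfK//; exact: dyadic_mean_spread.
Qed.
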